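(* Let $\mathbb{K}$ be a field, $n$ a positive integer and $R=\mathbb{K}[x_1,\dots,x_n]$. Let $\mathcal{C}_n$ be the Betti cone generated by all Betti diagrams $\beta(I(G))$ of edge ideals $I(G)$ in $R$ (for $G$ a graph on vertex set $\{1,\dots,n\}$). Then $$\dim\mathcal{C}_n=\begin{cases} r^2 & \text{if } n=2r,\\ r^2+r & \text{if } n=2r+1.\end{cases}$$
   Context: $R$ is standard graded. For a finitely generated graded $R$-module $M$ with minimal graded free resolution $0\to\bigoplus_{d}R(-d)^{\beta_{p,d}}\to\dots\to\bigoplus_d R(-d)^{\beta_{0,d}}\to M\to0$, the Betti diagram of $M$ is $\beta(M)=(\beta_{i,d})_{0\le i\le n,\,d\in\mathbb{Z}}$, viewed as a vector in the rational vector space $\bigoplus_{d\in\mathbb{Z}}\mathbb{Q}^{n+1}$. Ideals are resolved as $R$-modules. A graph $G$ on $[n]=\{1,\dots,n\}$ is given by a set $E(G)$ of 2-element subsets of $[n]$. Its edge ideal is $I(G)=\langle x_ix_j:\{i,j\}\in E(G)\rangle\subseteq R$. The Betti cone generated by a set of diagrams is the convex cone of nonnegative rational linear combinations of them; its dimension is the dimension of its $\mathbb{Q}$-linear span. *)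

(* Defs.v *)
From HB Require Import structures.
From mathcomp Require Import all_boot all_order all_algebra.
From mathcomp Require Import mpoly.
From mathcomp Require Import (canonicals) monalg.

Set Implicit Arguments.
Unset Strict Implicit.
Unset Printing Implicit Defensive.

Import GRing.Theory Num.Theory.
Local Open Scope ring_scope.

Definition ideal_gen (R : comNzRingType) (S : R -> Prop) (f : R) : Prop :=
  exists (m : nat) (a g : 'I_m -> R),
    (forall k, S (g k)) /\ f = \sum_(k < m) a k * g k.

Definition irrelevant_ideal (K : fieldType) (n : nat) : {mpoly K[n]} -> Prop :=
  ideal_gen (fun f : {mpoly K[n]} => exists i : 'I_n, f = 'X_i).

(* The vertex set [n] is 'I_n; a graph is identified with its edge set. *)
Definition is_graph (n : nat) (E : {set {set 'I_n}}) : Prop :=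
  forall e, e \in E -> #|e| = 2%N.

Definition edge_ideal (K : fieldType) (n : nat) (E : {set {set 'I_n}}) :
    {mpoly K[n]} -> Prop :=
  ideal_gen (fun f : {mpoly K[n]} =>
    exists i j : 'I_n, [set i; j] \in E /\ f = 'X_i * 'X_j).

(* Standard grading, indexed by all integers: R_d = 0 for d < 0. *)
Definition zhomog (K : fieldType) (n : nat) (d : int) (f : {mpoly K[n]}) : Prop :=
  match d with
  | Posz m => f \is m.-homog
  | Negz _ => f = 0
  end.

(* F_i is the direct sum of the R(- shift i j) for j < rank i, written as row
   vectors; its j-th basis vector has degree shift i j. The maps
   [diff i] : F_(i+1) -> F_i and [aug] : F_0 -> R act by right
   multiplication. *)
Record free_complex (K : fieldType) (n : nat) := FreeComplex {
  rank : nat -> nat;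
  shift : forall i : nat, 'I_(rank i) -> int;
  diff : forall i : nat, 'M[{mpoly K[n]}]_(rank i.+1, rank i);
  aug : 'cV[{mpoly K[n]}]_(rank 0%N)
}.

Arguments shift {K n} F i j : rename.

Definition graded_maps (K : fieldType) (n : nat) (F : free_complex K n) : Prop :=
  (forall j, zhomog (shift F 0%N j) (aug F j 0)) /\
  (forall i j k, zhomog (shift F i.+1 j - shift F i k) (diff F i j k)).

Definition finite_length (K : fieldType) (n : nat) (F : free_complex K n) : Prop :=
  exists p : nat, forall i : nat, (p < i)%N -> rank F i = 0%N.

(* Exactness of ... -> F_1 -> F_0 -> I -> 0, for an ideal I of R. *)
Definition exact_onto (K : fieldType) (n : nat) (F : free_complex K n)
    (I : {mpoly K[n]} -> Prop) : Prop :=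
  [/\ forall f, I f <-> exists v : 'rV_(rank F 0%N), v *m aug F = f%:M,
      forall v : 'rV_(rank F 0%N),
        v *m aug F = 0 <-> exists w : 'rV_(rank F 1%N), v = w *m diff F 0%N
    & forall i (v : 'rV_(rank F i.+1)),
        v *m diff F i = 0 <-> exists w : 'rV_(rank F i.+2), v = w *m diff F i.+1].

(* The image of F_(i+1) lies in m F_i, for m the irrelevant ideal. *)
Definition minimal_maps (K : fieldType) (n : nat) (F : free_complex K n) : Prop :=
  forall i j k, irrelevant_ideal (diff F i j k).

Definition minimal_graded_free_resolution (K : fieldType) (n : nat)
    (F : free_complex K n) (I : {mpoly K[n]} -> Prop) : Prop :=
  [/\ graded_maps F, finite_length F, exact_onto F I & minimal_maps F].

(* Finitely supported families of rationals indexed by (i, d), 0 <= i <= n and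
   d an integer, i.e. the direct sum over d of Q^(n+1). *)
Definition diagram (n : nat) : lmodType rat :=
  monalg.malg ('I_n.+1 * int)%type rat.

Definition coef (n : nat) (D : diagram n) (i : 'I_n.+1) (d : int) : rat :=
  monalg.mcoeff (i, d) D.

Definition unit_diagram (n : nat) (i : 'I_n.+1) (d : int) : diagram n :=
  monalg.mkmalgU (i, d) 1.

Definition diagram_of (K : fieldType) (n : nat) (F : free_complex K n) :
    diagram n :=
  \sum_(i < n.+1) \sum_(j < rank F i) unit_diagram i (shift F i j).

Lemma coef_diagram_of (K : fieldType) (n : nat) (F : free_complex K n) i d :
  coef (diagram_of F) i d = #|[set j : 'I_(rank F i) | shift F i j == d]|%:R.
Proof.
have cD : {morph (fun D : diagram n => coef D i d) : x y / x + y}.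
  by move=> x y; exact: monalg.mcoeffD.
have c0 : coef (0 : diagram n) i d = 0 by exact: monalg.mcoeff0.
have cU k e : coef (unit_diagram k e : diagram n) i d = ((k, e) == (i, d))%:R.
  exact: monalg.mcoeffU.
rewrite /diagram_of (big_morph _ cD c0) (bigD1 i) //=.
rewrite [X in _ + X]big1 ?addr0 => [|k ki].
  rewrite (big_morph _ cD c0) -sum1dep_card natr_sum [RHS]big_mkcond /=.
  by apply: eq_bigr => j _; rewrite cU xpair_eqE eqxx; case: eqP.
rewrite (big_morph _ cD c0) big1 // => j _.
by rewrite cU xpair_eqE (negPf ki).
Qed.

Definition is_betti_diagram (K : fieldType) (n : nat)
    (I : {mpoly K[n]} -> Prop) (D : diagram n) : Prop :=
  exists F : free_complex K n,
    minimal_graded_free_resolution F I /\ D = diagram_of F.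

Definition cone (V : lmodType rat) (S : V -> Prop) (v : V) : Prop :=
  exists (m : nat) (c : 'I_m -> rat) (w : 'I_m -> V),
    [/\ forall k, 0 <= c k, forall k, S (w k) & v = \sum_(k < m) c k *: w k].

Definition lin_span (V : lmodType rat) (S : V -> Prop) (v : V) : Prop :=
  exists (m : nat) (c : 'I_m -> rat) (w : 'I_m -> V),
    (forall k, S (w k)) /\ v = \sum_(k < m) c k *: w k.

Definition lin_indep (V : lmodType rat) (m : nat) (b : 'I_m -> V) : Prop :=
  forall c : 'I_m -> rat, \sum_(k < m) c k *: b k = 0 -> forall k, c k = 0.

Definition has_dim (V : lmodType rat) (W : V -> Prop) (m : nat) : Prop :=
  exists b : 'I_m -> V,
    [/\ forall k, W (b k), lin_indep b
      & forall v, W v -> exists c : 'I_m -> rat, v = \sum_(k < m) c k *: b k].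

Definition cone_has_dim (V : lmodType rat) (C : V -> Prop) (m : nat) : Prop :=
  has_dim (lin_span C) m.

Definition edge_betti_cone (K : fieldType) (n : nat) : diagram n -> Prop :=
  cone (fun D : diagram n => exists E : {set {set 'I_n}},
    is_graph E /\ is_betti_diagram (@edge_ideal K n E) D).

(* Main.v *)
From HB Require Import structures.
Require Import Defs.
From mathcomp Require Import all_boot all_order all_algebra.
From mathcomp Require Import mpoly.
From mathcomp Require monalg.
From mathcomp Require Import zify.

(* The i-th syzygies of I(G) of degree d = i + k + 2 can only occur for
   0 <= k <= i and i + k + 2 <= n, and there are r^2 or r^2 + r such pairs
   (i, k). The bound d >= i + 2 follows from minimality. For the others, a
   minimal resolution F is a direct summand of any graded free resolution, so
   its shifts occur in the Taylor resolution, where the shifts in homological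
   degree i are the sizes of unions of i + 1 edges, hence at most n and at most
   2(i + 1).
   Conversely, every edge of a star forest has a private vertex, which makes
   its Taylor resolution minimal. The disjoint union of k edges and a star with
   i + 1 - k edges has i + 1 edges and k + 1 components, so its Betti diagram is
   nonzero at (i, k) and vanishes at (i', k') unless i' <= i and k' <= k. These
   diagrams form a triangular system, hence a basis of the span. *)

Set Implicit Arguments.
Unset Strict Implicit.
Unset Printing Implicit Defensive.

Import GRing.Theory Num.Theory.
Local Open Scope ring_scope.

(** * Graded polynomials and comparison of resolutions *)

Section GradedPolynomials.
Variables (K : fieldType) (n : nat).
Implicit Types (p q f g : {mpoly K[n]}) (d e : int).

Lemma zhomogP d f : zhomog d f <-> forall m, f@_m != 0 -> (mdeg m)%:Z = d.
Proof.
case: d => [k|k] /=; split.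
- by move/dhomogP=> h m; rewrite -mcoeff_msupp => /h <-.
- by move=> h; apply/dhomogP=> m; rewrite mcoeff_msupp => /h [].
- by move=> -> m; rewrite mcoeff0 eqxx.
- move=> h; apply/mpolyP=> m; rewrite mcoeff0; apply/eqP.
  by apply: contraT=> /h.
Qed.

Lemma zhomog0 d : zhomog d (0 : {mpoly K[n]}).
Proof. by apply/zhomogP=> m; rewrite mcoeff0 eqxx. Qed.

Lemma zhomogD d f g : zhomog d f -> zhomog d g -> zhomog d (f + g).
Proof. by case: d => [k|k] /=; [exact: rpredD | move=> -> ->; rewrite addr0]. Qed.

Lemma zhomogM d e f g : zhomog d f -> zhomog e g -> zhomog (d + e) (f * g).
Proof.
case: d => [a|a]; last by move=> /= ->; rewrite mul0r => _; apply: zhomog0.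
case: e => [b|b]; last by move=> _ /= ->; rewrite mulr0; apply: zhomog0.
exact: dhomogM.
Qed.

Lemma zhomog_sum (I : finType) (P : pred I) d (F : I -> {mpoly K[n]}) :
  (forall i, P i -> zhomog d (F i)) -> zhomog d (\sum_(i | P i) F i).
Proof. by move=> h; elim/big_ind: _ => //; [apply: zhomog0 | apply: zhomogD]. Qed.

Definition zcomp d f : {mpoly K[n]} :=
  if d is Posz k then pihomog mdeg k f else 0.

Lemma zcompD d : {morph zcomp d : f g / f + g}.
Proof. by case: d => [k|k] f g /=; [exact: pihomogD | rewrite addr0]. Qed.

Lemma zcomp0 d : zcomp d 0 = 0.
Proof. by case: d => // k; exact: pihomog0. Qed.

Lemma zcompZ d c f : zcomp d (c *: f) = c *: zcomp d f.
Proof. by case: d => [k|k] /=; [exact: linearZ | rewrite scaler0]. Qed.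

Lemma zhomog_zcomp d f : zhomog d (zcomp d f).
Proof. by case: d => //= k; exact: pihomogP. Qed.

Lemma zcomp_homog d e f : zhomog e f -> zcomp d f = if d == e then f else 0.
Proof.
case: d => [a|a] /=; case: e => [b|b] /=.
- rewrite eqz_nat; case: eqVneq => [-> /pihomog_dE //|ab].
  by apply: pihomog_ne0; rewrite eq_sym.
- by move=> ->; rewrite pihomog0.
- by [].
- by move=> ->; rewrite if_same.
Qed.

(** By linearity [p] may be taken to be a monomial; then [p * q] is homogeneous and both sides test
    the same degree equality. *)
Lemma zcompM d e p q : zhomog e q -> zcomp (d + e) (p * q) = zcomp d p * q.
Proof.
move=> hq; rewrite {1 2}(mpolyE p) mulr_suml.
rewrite !(big_morph _ (zcompD _) (zcomp0 _)) mulr_suml; apply: eq_bigr => m _.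
rewrite -scalerAl !zcompZ -scalerAl; congr (_ *: _).
have hm : zhomog (mdeg m)%:Z ('X_[m] : {mpoly K[n]}) by rewrite /= dhomogX.
rewrite (zcomp_homog _ hm) (zcomp_homog _ (zhomogM hm hq)).
by rewrite (inj_eq (addIr e)); case: ifP; rewrite ?mul0r.
Qed.

Lemma mcoeff0M f g : (f * g)@_0%MM = f@_0%MM * g@_0%MM.
Proof. by have [h _] := mcoeff0_is_multiplicative n K; exact: h. Qed.

Lemma irrelevant_mcoeff0 f : irrelevant_ideal f -> f@_0%MM = 0.
Proof.
case=> m [a [g [hg ->]]]; rewrite raddf_sum /= big1 // => k _.
by case: (hg k) => i ->; rewrite mcoeff0M mcoeffX mnm1_eq0 mulr0.
Qed.

Lemma irrelevant_monomial (a : 'X_{1..n}) f :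
  a != 0%MM -> irrelevant_ideal ('X_[a] * f).
Proof.
move=> a0; have [i ai] : exists i, (0 < a i)%N.
  apply/existsP; apply: contraNT a0; rewrite negb_exists => /forallP h.
  by apply/eqP/mnmP=> i; move: (h i); rewrite lt0n negbK mnm0E => /eqP.
exists 1%N, (fun _ => f * 'X_[(a - U_(i))%MM]), (fun _ => 'X_i); split.
  by move=> _; exists i.
rewrite big_ord1 -mulrA -mpolyXD submK; first by rewrite mulrC.
by apply/mnm_lepP=> l; rewrite mnm1E; case: eqP => // <-.
Qed.

(** Matrices of degree-0 maps between graded free modules whose basis vectors have degrees [s] and
    [t]. *)
Definition hgraded (a b : nat) (s : 'I_a -> int) (t : 'I_b -> int)
    (X : 'M[{mpoly K[n]}]_(a, b)) :=
  forall j k, zhomog (s j - t k) (X j k).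

Lemma hgraded_mul a b c (s : 'I_a -> int) (t : 'I_b -> int) (u : 'I_c -> int)
    X Y : hgraded s t X -> hgraded t u Y -> hgraded s u (X *m Y).
Proof.
move=> hX hY j k; rewrite mxE; apply: zhomog_sum => l _.
by have := zhomogM (hX j l) (hY l k); rewrite addrA subrK.
Qed.

(** Keep in each entry of [W] only the component of the expected degree: as [X] and [Y] are
    homogeneous, the product does not change. This makes lifts obtained from exactness graded. *)
Lemma hgraded_factor a b c (s : 'I_a -> int) (t : 'I_b -> int)
    (u : 'I_c -> int) X Y W :
  hgraded s u X -> hgraded t u Y -> X = W *m Y ->
  exists2 W', hgraded s t W' & X = W' *m Y.
Proof.
move=> hX hY eX; exists (\matrix_(j, l) zcomp (s j - t l) (W j l)).
  by move=> j l; rewrite mxE; apply: zhomog_zcomp.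
apply/matrixP=> j k; transitivity (zcomp (s j - u k) (X j k)).
  by rewrite (zcomp_homog _ (hX j k)) eqxx.
rewrite eX !mxE (big_morph _ (zcompD _) (zcomp0 _)); apply: eq_bigr => l _.
by rewrite mxE -(zcompM _ _ (hY l k)) addrA subrK.
Qed.

End GradedPolynomials.

Lemma rows_factor (A : comNzRingType) a b c (X : 'M[A]_(a, b)) (Y : 'M[A]_(c, b)) :
  (forall j, exists w : 'rV_c, row j X = w *m Y) -> exists W, X = W *m Y.
Proof.
case/fin_all_exists=> w hw; exists (\matrix_(j, k) w j 0 k).
apply/row_matrixP=> j; rewrite row_mul hw; congr (_ *m _).
by apply/rowP=> k; rewrite !mxE.
Qed.

(** * Comparison maps between augmented resolutions *)

Section Augmented.
Variables (K : fieldType) (n : nat).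
Implicit Types (F G : free_complex K n) (I : {mpoly K[n]} -> Prop).

(** The complex is shifted by one, with [R] itself in position 0, so that the augmentation and the
    differentials form one family and inductions treat them alike. *)
Definition aug_rank F i : nat := if i is i'.+1 then rank F i' else 1%N.

Definition aug_shift F i : 'I_(aug_rank F i) -> int :=
  match i with 0 => fun _ => 0 | i'.+1 => @shift K n F i' end.

Definition aug_diff F i : 'M[{mpoly K[n]}]_(aug_rank F i.+1, aug_rank F i) :=
  match i with 0 => aug F | i'.+1 => diff F i' end.

Lemma aug_diff_hgraded F i :
  graded_maps F -> hgraded (@aug_shift F i.+1) (@aug_shift F i) (aug_diff F i).
Proof.
case=> h0 h1; case: i => [|i] j k /=; last exact: h1.
by rewrite subr0 (ord1 k); apply: h0.
Qed.

Lemma aug_diff_exact F I i (v : 'rV_(aug_rank F i.+1)) : exact_onto F I ->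
  v *m aug_diff F i = 0 <-> exists w, v = w *m aug_diff F i.+1.
Proof. by case=> _ h1 h2; case: i v => [|i] v; [apply: h1 | apply: h2]. Qed.

Lemma aug_diff_sq F I i : exact_onto F I -> aug_diff F i.+1 *m aug_diff F i = 0.
Proof.
move=> ex; apply/row_matrixP=> j; rewrite row_mul row0.
by apply/(aug_diff_exact _ ex); exists (delta_mx 0 j); rewrite rowE.
Qed.

Lemma aug_diff_factor F I i a (X : 'M_(a, aug_rank F i.+1)) : exact_onto F I ->
  X *m aug_diff F i = 0 -> exists W, X = W *m aug_diff F i.+1.
Proof.
move=> ex X0; apply: rows_factor => j.
by apply/(aug_diff_exact _ ex); rewrite -row_mul X0 row0.
Qed.

Lemma aug_factor F G I : exact_onto F I -> exact_onto G I ->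
  exists W, aug F = W *m aug G.
Proof.
move=> [F0 _ _] [G0 _ _]; apply: rows_factor => j.
have/G0[w hw] : I (aug F j 0).
  apply/F0; exists (delta_mx 0 j); rewrite -rowE.
  by apply/rowP=> k; rewrite (ord1 k) !mxE eqxx.
by exists w; rewrite hw; apply/rowP=> k; rewrite (ord1 k) !mxE eqxx.
Qed.

(** Vanishing after tensoring with the residue field: the constant coefficient is reduction modulo
    the irrelevant ideal. *)
Definition null_mod a b (X : 'M[{mpoly K[n]}]_(a, b)) :=
  forall j k, (X j k)@_0%MM = 0.

Lemma null_mod_mulr a b c (X : 'M_(a, b)) (Y : 'M_(b, c)) :
  null_mod X -> null_mod (X *m Y).
Proof.
by move=> h j k; rewrite mxE raddf_sum big1 //= => l _; rewrite mcoeff0M h mul0r.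
Qed.

Lemma null_mod_mull a b c (X : 'M_(a, b)) (Y : 'M_(b, c)) :
  null_mod Y -> null_mod (X *m Y).
Proof.
by move=> h j k; rewrite mxE raddf_sum big1 //= => l _; rewrite mcoeff0M h mulr0.
Qed.

(* One stage of: comparison maps phi : F -> G and psi : G -> F over the
   identity of I, phi being graded, with a homotopy s from psi phi to 1. *)
Lemma comparison F G I i : graded_maps F -> graded_maps G ->
  exact_onto F I -> exact_onto G I -> minimal_maps F ->
  exists (phi : 'M_(aug_rank F i, aug_rank G i))
    (phi' : 'M_(aug_rank F i.+1, aug_rank G i.+1))
    (psi : 'M_(aug_rank G i, aug_rank F i))
    (psi' : 'M_(aug_rank G i.+1, aug_rank F i.+1))
    (s : 'M_(aug_rank F i, aug_rank F i.+1))
    (s' : 'M_(aug_rank F i.+1, aug_rank F i.+2)),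
  [/\ phi' *m aug_diff G i = aug_diff F i *m phi,
      psi' *m aug_diff F i = aug_diff G i *m psi,
      hgraded (@aug_shift F i.+1) (@aug_shift G i.+1) phi',
      1%:M - phi' *m psi' = s' *m aug_diff F i.+1 + aug_diff F i *m s
    & null_mod (aug_diff F i *m s)].
Proof.
move=> gF gG xF xG mF; elim: i => [|i IH].
  have [W eW] := aug_factor xF xG; have [psi epsi] := aug_factor xG xF.
  have hF : hgraded (@aug_shift F 1) (@aug_shift G 0) (aug F).
    exact: (aug_diff_hgraded (i := 0) gF).
  have hG := aug_diff_hgraded (i := 0) gG.
  have [phi hphi ephi] := hgraded_factor hF hG eW.
  have [] := aug_diff_factor (i := 0) (X := 1%:M - phi *m psi) xF.
    by rewrite mulmxBl mul1mx -mulmxA -epsi -ephi subrr.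
  (* The maps start from the identity of [R]. The homotopy starts at 0, which gives the last clause
     here: [minimal_maps] says nothing about the entries of [aug F]. *)
  move=> s' es'; exists 1%:M, phi, 1%:M, psi, 0, s'; split=> //.
  - by rewrite mulmx1 -ephi.
  - by rewrite mulmx1 -epsi.
  - by rewrite mulmx0 addr0.
  - by rewrite mulmx0 => j k; rewrite mxE mcoeff0.
case: IH => phi [phi' [psi [psi' [s [s' [e1 e2 hphi e3 _]]]]]].
have [] := aug_diff_factor (i := i) (X := aug_diff F i.+1 *m phi') xG.
  by rewrite -mulmxA e1 mulmxA (aug_diff_sq _ xF) mul0mx.
move=> W eW; have [phi2 hphi2 ephi2] := hgraded_factor
    (hgraded_mul (aug_diff_hgraded gF) hphi) (aug_diff_hgraded gG) eW.
have [] := aug_diff_factor (i := i) (X := aug_diff G i.+1 *m psi') xF.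
  by rewrite -mulmxA e2 mulmxA (aug_diff_sq _ xG) mul0mx.
move=> psi2 epsi2.
(* Usual construction of a homotopy: what remains of 1 - phi psi after subtracting the known term is
   a cycle, hence factors through the next differential. *)
have [] := aug_diff_factor (i := i.+1)
    (X := 1%:M - phi2 *m psi2 - aug_diff F i.+1 *m s') xF.
  rewrite !mulmxBl mul1mx -(mulmxA phi2) -epsi2 (mulmxA phi2) -ephi2.
  rewrite -!mulmxA -[X in X - _ - _]mulmx1 -!mulmxBr e3.
  by rewrite [X in X - _]addrC addrK mulmxA (aug_diff_sq _ xF) mul0mx.
move=> s2 es2; exists phi', phi2, psi', psi2, s', s2; split=> //.
  by rewrite -es2 subrK.
by apply: null_mod_mulr => j k; apply/irrelevant_mcoeff0/mF.
Qed.

(** Modulo the irrelevant ideal the homotopy terms vanish, so [phi' *m psi'] reduces to the identity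
    and row [j] of [phi'] has an entry with nonzero constant term. That entry is homogeneous, hence
    of degree 0, which equates the two shifts. *)
Lemma minimal_shift_in F G I i (j : 'I_(rank F i)) :
  minimal_graded_free_resolution F I -> graded_maps G -> exact_onto G I ->
  exists l : 'I_(rank G i), shift G i l = shift F i j.
Proof.
move=> [gF _ xF mF] gG xG.
have [phi [phi' [psi [psi' [s [s' [_ _ hphi e n0]]]]]]] :=
  comparison i gF gG xF xG mF.
have : null_mod (1%:M - phi' *m psi').
  rewrite e => a b; rewrite mxE mcoeffD n0 addr0.
  by apply: null_mod_mull => c d; apply/irrelevant_mcoeff0/mF.
move/(_ j j)/eqP; rewrite !mxE eqxx mcoeffB mcoeff1 eqxx subr_eq0 raddf_sum /=.
move=> sum1; have [l hl] : exists l, (phi' j l)@_0%MM != 0.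
  apply/existsP; apply: contraT; rewrite negb_exists => /forallP h.
  move: sum1; rewrite big1 ?oner_eq0 // => l _.
  by move: (h l); rewrite negbK mcoeff0M => /eqP ->; rewrite mul0r.
exists l; have /zhomogP/(_ _ hl) := hphi j l.
by rewrite mdeg0 => /esym/eqP; rewrite subr_eq0 => /eqP.
Qed.

(** Otherwise the basis vector [j] would be a cycle, hence a boundary, and by minimality its
    coordinate 1 would lie in the irrelevant ideal. *)
Lemma minimal_row_neq0 F I i (j : 'I_(rank F i)) :
  minimal_graded_free_resolution F I -> exists k, aug_diff F i j k != 0.
Proof.
move=> [gF _ xF mF]; apply/existsP.
apply: contraT; rewrite negb_exists => /forallP h.
have : (delta_mx 0 j : 'rV_(aug_rank F i.+1)) *m aug_diff F i = 0.
  by rewrite -rowE; apply/rowP=> k; rewrite !mxE; apply/eqP; rewrite -[_ == _]negbK.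
move/(aug_diff_exact _ xF)=> [w /rowP/(_ j)]; rewrite mxE !eqxx /= => e.
have: null_mod (w *m aug_diff F i.+1).
  by apply: null_mod_mull => c d; apply/irrelevant_mcoeff0/mF.
by move/(_ 0 j)/eqP; rewrite -e mcoeff1 eqxx oner_eq0.
Qed.

(** Each row of a differential has a nonzero entry, of positive degree by minimality, so the least
    shift grows by at least 1 per step. *)
Lemma minimal_shift_ge F I c i (j : 'I_(rank F i)) :
  (forall f m, I f -> f@_m != 0 -> (c <= mdeg m)%N) ->
  minimal_graded_free_resolution F I -> (i + c)%:Z <= shift F i j.
Proof.
move=> hI mF; have [[g0 g1] _ xF mM] := mF; elim: i j => [|i IH] j.
  have [k] := minimal_row_neq0 j mF; rewrite (ord1 k) {k} /= => nz.
  have [m hm] : exists m, (aug F j 0)@_m != 0.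
    by exists (mlead (aug F j 0)); rewrite mleadc_eq0.
  have /zhomogP/(_ _ hm) <- := g0 j; rewrite add0n lez_nat.
  apply: hI hm; have [F0 _ _] := xF; apply/F0; exists (delta_mx 0 j).
  by rewrite -rowE; apply/rowP=> l; rewrite (ord1 l) !mxE eqxx.
have [k /= nz] := minimal_row_neq0 j mF.
have [m hm] : exists m, (diff F i j k)@_m != 0.
  by exists (mlead (diff F i j k)); rewrite mleadc_eq0.
have /zhomogP/(_ _ hm) dm := g1 i j k.
have: (0 < mdeg m)%N.
  rewrite lt0n mdeg_eq0; apply: contraNneq hm => ->.
  exact/eqP/irrelevant_mcoeff0/mM.
rewrite -ltz_nat dm subr_gt0 => lt.
rewrite (_ : (i.+1 + c)%:Z = (i + c)%:Z + 1); last by rewrite addSn -addn1 PoszD.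
by rewrite lezD1; apply: Order.POrderTheory.le_lt_trans lt.
Qed.

End Augmented.

(** * The Taylor resolution *)

Lemma mcoeffXM (K : comNzRingType) n (a c : 'X_{1..n}) (p : {mpoly K[n]}) :
  ('X_[a] * p)@_c = if (a <= c)%MM then p@_(c - a)%MM else 0.
Proof.
case: ifP => [ac|nac].
  by rewrite -[in LHS](submK ac) addmC mulrC mcoeffMX.
rewrite mcoeffM big1 // => k /eqP ck; rewrite mcoeffX.
case: eqP => [e|]; last by rewrite mul0r.
by rewrite ck -e lem_addr in nac.
Qed.

(** The terms with [e < f] cancel those with [f < e]. The diagonal needs its own hypothesis, since
    antisymmetry does not kill it in characteristic 2. *)
Lemma alternating_sum (V : zmodType) q (g : 'I_q -> 'I_q -> V) :
  (forall e, g e e = 0) -> (forall e f, g e f = - g f e) ->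
  \sum_e \sum_f g e f = 0.
Proof.
move=> g0 gN; pose h (e f : 'I_q) := if (e < f)%N then g e f else 0.
have -> : \sum_e \sum_f g e f = \sum_e \sum_f h e f + \sum_e \sum_f (- h f e).
  rewrite -big_split; apply: eq_bigr => e _; rewrite -big_split /=.
  apply: eq_bigr => f _; rewrite /h; case: ltngtP => [||/val_inj ->].
  - by rewrite subr0.
  - by rewrite add0r -gN.
  - by rewrite g0 subr0.
rewrite [X in _ + X]exchange_big -big_split big1 // => e _.
by rewrite -big_split big1 // => f _; rewrite /= subrr.
Qed.

Lemma big_setU1_cond (V : nmodType) q (B : {set 'I_q}) (e : 'I_q) (F : 'I_q -> V) :
  e \notin B ->
  \sum_(f | f \notin B) F f = F e + \sum_(f | f \notin e |: B) F f.
Proof.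
move=> eB; rewrite (bigD1 e) //=; congr (_ + _); apply: eq_bigl => f.
by rewrite !inE negb_or andbC.
Qed.

(** * Signs and contraction of the simplex *)

Section Signs.
Variables (K : fieldType) (q : nat).
Implicit Types (e f : 'I_q) (A B : {set 'I_q}).

(** For [e] outside [B], the incidence sign of the face [B] in the simplex [e |: B]. *)
Definition sgn e B : K := (-1) ^+ #|[set f in B | (f < e)%N]|.

Lemma sgn_sq e B : sgn e B * sgn e B = 1.
Proof. by rewrite /sgn -expr2 sqrr_sign. Qed.

Lemma sgn0 e : sgn e set0 = 1.
Proof.
rewrite /sgn (_ : [set _ in _ | _] = set0) ?cards0 //.
by apply/setP=> x; rewrite !inE.
Qed.

Lemma sgnU1 e f B : f \notin B -> sgn e (f |: B) = (-1) ^+ (f < e)%N * sgn e B.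
Proof.
move=> fB; rewrite /sgn -exprD; congr (_ ^+ _).
rewrite (cardsD1 f) !inE eqxx /=; congr (_ + _)%N; apply: eq_card => x.
by rewrite !inE; case: eqVneq => // ->; rewrite (negPf fB).
Qed.

Lemma sgn_swap e f B : e != f -> e \notin B -> f \notin B ->
  sgn e B * sgn f (e |: B) = - (sgn f B * sgn e (f |: B)).
Proof.
move=> ef eB fB; rewrite !sgnU1 // mulrCA (mulrCA (sgn f B)).
rewrite [sgn f B * _]mulrC -mulNr; congr (_ * _).
case: ltngtP ef => [||/val_inj ->]; rewrite ?expr0 ?expr1 ?opprK ?eqxx //.
Qed.

Lemma sgnU1_swap e f B : e != f -> e \notin B -> f \notin B ->
  sgn e (f |: B) * sgn f (e |: B) = - (sgn f B * sgn e B).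
Proof.
move=> ef eB fB; rewrite !sgnU1 // mulrACA (mulrC (sgn f B)) -[RHS]mulN1r.
congr (_ * _).
by case: ltngtP ef => [||/val_inj ->]; rewrite ?expr0 ?expr1 ?mulr1 ?mul1r ?eqxx.
Qed.

(* A full simplex is contracted by coning over the vertex e0. *)
Lemma simplex_contraction (f : {set 'I_q} -> K) e0 B :
  (forall C : {set 'I_q}, \sum_(e | e \notin C) sgn e C * f (e |: C) = 0) ->
  \sum_(e | e \notin B) sgn e B *
    (if e0 \in e |: B then sgn e0 ((e |: B) :\ e0) * f ((e |: B) :\ e0) else 0)
  = f B.
Proof.
move=> f0; have [e0B|e0B] := boolP (e0 \in B); last first.
  (* If [e0] is not in [B], only the term [e = e0] survives. *)
  rewrite (bigD1 e0) //= setU11 setU1K // mulrA sgn_sq mul1r big1 ?addr0 //.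
  move=> e /andP[eB ne]; rewrite !inE eq_sym (negPf ne) (negPf e0B).
  by rewrite mulr0.
(* If [e0] is in [B], the cycle condition at [C] expresses [f B] through the other cofaces of
   [C]. *)
pose C := B :\ e0; have e0C : e0 \notin C by rewrite !inE eqxx.
have BE : B = e0 |: C by rewrite setD1K.
have /eqP := f0 C; rewrite (big_setU1_cond _ e0C) -BE addr_eq0 => /eqP fB.
rewrite -[RHS]mul1r -(sgn_sq e0 C) -mulrA fB mulrN mulr_sumr -sumrN.
apply: eq_bigr => e eB; rewrite in_setU e0B orbT.
have ne : e != e0 by apply: contraNneq eB => ->.
have eC : e \notin C by rewrite !inE negb_and eB orbT.
have -> : (e |: B) :\ e0 = e |: C.
  by apply/setP=> x; rewrite !inE; case: eqVneq => // ->; rewrite eq_sym (negPf ne).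
rewrite !mulrA -mulNr; congr (_ * _).
by rewrite BE sgnU1_swap // opprK.
Qed.

End Signs.

Section Taylor.
Variables (K : fieldType) (n q : nat) (m : 'I_q -> 'X_{1..n}).
Implicit Types (e f : 'I_q) (A B C : {set 'I_q}) (a c : 'X_{1..n}).
Implicit Types v w : {set 'I_q} -> {mpoly K[n]}.

(** Exponent of the least common multiple of the monomials indexed by [A]. *)
Definition mlcms A : 'X_{1..n} := [multinom \max_(k in A) m k i | i < n].

Lemma mlcms_lep A a :
  reflect (forall k, k \in A -> (m k <= a)%MM) (mlcms A <= a)%MM.
Proof.
apply: (iffP mnm_lepP) => [h k kA|h i].
  apply/mnm_lepP=> i; apply: leq_trans (h i); rewrite mnmE.
  exact: (leq_bigmax_cond (F := fun k => m k i) k kA).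
by rewrite mnmE; apply/bigmax_leqP=> k /h /mnm_lepP.
Qed.

Lemma mlcms_sub A B : A \subset B -> (mlcms A <= mlcms B)%MM.
Proof.
by move=> /subsetP sAB; apply/mlcms_lep=> k /sAB; apply/mlcms_lep/lepm_refl.
Qed.

Lemma mlcmsU1 e A : (mlcms A <= mlcms (e |: A))%MM.
Proof. exact/mlcms_sub/subsetUr. Qed.

Lemma mlcms0 : mlcms set0 = 0%MM.
Proof. by apply/mnmP=> i; rewrite mnmE mnm0E big_set0. Qed.

Lemma mlcms1 e : mlcms [set e] = m e.
Proof. by apply/mnmP=> i; rewrite mnmE big_set1. Qed.

(** Matrix entry of the Taylor differential. At most one [e] satisfies the test; the sum avoids
    having to choose it. *)
Definition taylor_coef A B : {mpoly K[n]} :=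
  \sum_(e | e \notin B)
    if A == e |: B then sgn K e B *: 'X_[(mlcms A - mlcms B)%MM] else 0.

(** The differential acts on families over all subsets at once, so its value at [set0] is the
    augmentation. *)
Definition tdiff v B : {mpoly K[n]} :=
  \sum_(e | e \notin B)
    sgn K e B *: ('X_[(mlcms (e |: B) - mlcms B)%MM] * v (e |: B)).

Lemma tdiffE v B : tdiff v B = \sum_A v A * taylor_coef A B.
Proof.
rewrite /taylor_coef; under [RHS]eq_bigr do rewrite mulr_sumr.
rewrite exchange_big; apply: eq_bigr => e _; rewrite (bigD1 (e |: B)) //=.
rewrite eqxx big1 ?addr0 => [|A /negPf ->]; last by rewrite mulr0.
by rewrite -scalerAr mulrC.
Qed.

Lemma eq_tdiff v w B :
  (forall e, e \notin B -> v (e |: B) = w (e |: B)) -> tdiff v B = tdiff w B.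
Proof. by move=> h; apply: eq_bigr => e /h ->. Qed.

(** The monomial quotients telescope to an expression symmetric in the two added vertices, while the
    signs are antisymmetric. *)
Lemma tdiff_tdiff v B : tdiff (tdiff v) B = 0.
Proof.
pose g e f : {mpoly K[n]} :=
  if [&& e \notin B, f \notin B & e != f] then
    (sgn K e B * sgn K f (e |: B)) *:
      ('X_[(mlcms (f |: (e |: B)) - mlcms B)%MM] * v (f |: (e |: B)))
  else 0.
rewrite -[RHS](@alternating_sum _ _ g) => [|e|e f].
- rewrite [LHS]big_mkcond; apply: eq_bigr => e _; rewrite /g.
  case: (boolP (e \notin B)) => [eB|_] /=; last by rewrite big1.
  rewrite /tdiff mulr_sumr scaler_sumr big_mkcond; apply: eq_bigr => f _.
  rewrite !inE negb_or eq_sym andbC; case: ifP => // _.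
  rewrite -scalerAr scalerA mulrA -mpolyXD; congr (_ *: ('X_[_] * _)).
  apply/mnmP=> i; rewrite mnmDE !mnmBE addnC addnBA; last first.
    by have /mnm_lepP := mlcmsU1 e B.
  by rewrite subnK //; have /mnm_lepP := mlcmsU1 f (e |: B).
- by rewrite /g eqxx !andbF.
rewrite /g andbCA (eq_sym f e).
case: ifP => [/and3P[fB eB ne]|]; last by rewrite oppr0.
by rewrite (sgn_swap _ ne eB fB) scaleNr setUCA.
Qed.

(* The coefficient at e_A of the component of v of multidegree a, where e_A
   has multidegree mlcms A. *)
Definition strand v A a : K :=
  if (mlcms A <= a)%MM then (v A)@_(a - mlcms A)%MM else 0.

Lemma strandE v A c : strand v A (c + mlcms A)%MM = (v A)@_c.
Proof. by rewrite /strand lem_addl addmK. Qed.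

(** In a fixed multidegree the monomials disappear and the Taylor differential becomes the
    simplicial boundary. *)
Lemma mcoeff_tdiff v B c :
  (tdiff v B)@_c =
  \sum_(e | e \notin B) sgn K e B * strand v (e |: B) (c + mlcms B)%MM.
Proof.
rewrite raddf_sum; apply: eq_bigr => e _; rewrite /= mcoeffZ mcoeffXM.
congr (_ * _); rewrite /strand; have /mnm_lepP le1 := mlcmsU1 e B.
have -> : (mlcms (e |: B) - mlcms B <= c)%MM = (mlcms (e |: B) <= c + mlcms B)%MM.
  by apply/mnm_lepP/mnm_lepP=> h i; have := h i; have := le1 i;
    rewrite !(mnmBE, mnmDE) leq_subLR addnC.
case: ifP => // _; congr (_@_ _); apply/mnmP=> i.
by rewrite !(mnmBE, mnmDE) subnBA.
Qed.

Lemma strand_cycle v B a : (forall C, tdiff v C = 0) ->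
  \sum_(e | e \notin B) sgn K e B * strand v (e |: B) a = 0.
Proof.
move=> v0; have [Ba|nBa] := boolP (mlcms B <= a)%MM.
  by rewrite -(submK Ba) -mcoeff_tdiff v0 mcoeff0.
rewrite big1 // => e _; rewrite /strand ifN ?mulr0 //.
by apply: contraNN nBa; apply: lepm_trans (mlcmsU1 e B).
Qed.

Lemma mpoly_of_coefs N (F : 'X_{1..n} -> K) :
  (forall c, (N <= mdeg c)%N -> F c = 0) ->
  exists p : {mpoly K[n]}, forall c, p@_c = F c.
Proof.
move=> hF; exists (\sum_(c : 'X_{1..n < N}) (F c *: 'X_[c])) => c.
have [cN|Nc] := ltnP (mdeg c) N; first exact: mcoeff_mpoly.
rewrite hF // raddf_sum /= big1 // => b _; rewrite mcoeffZ mcoeffX.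
case: eqP => [bc|]; last by rewrite mulr0.
by have := bmdeg b; rewrite bc ltnNge Nc.
Qed.

(** In multidegree [a] the faces whose lcm divides ['X_[a]] form the full simplex on the [e] with
    [m e <= a]. It is contracted by coning over one such vertex; if there is none, only the empty
    face remains, where [v] vanishes. *)
Lemma taylor_exact v : (forall B, tdiff v B = 0) -> v set0 = 0 ->
  exists w, forall B, tdiff w B = v B.
Proof.
move=> v0 ve; pose vertex a := [pick e | (m e <= a)%MM].
pose W A a : K := if vertex a is Some e then
  (if e \in A then sgn K e (A :\ e) * strand v (A :\ e) a else 0) else 0.
(* Degree bound making the prescribed coefficients finitely many: passing from [A] to [A :\ e]
   lowers the lcm, so the coefficient of [v] that is read has degree at least [mdeg c]. *)
pose N := \max_A msize (v A).
have /fin_all_exists[w hw] A : exists p : {mpoly K[n]},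
    forall c, p@_c = W A (c + mlcms A)%MM.
  apply: (mpoly_of_coefs (N := N)) => c Nc; rewrite /W.
  case: (vertex _) => // e; case: ifP => // eA; rewrite /strand.
  have le1 : (mlcms (A :\ e) <= mlcms A)%MM by apply/mlcms_sub/subsetDl.
  rewrite (lepm_trans le1 (lem_addl _ _)) [X in _ * X](_ : _ = 0) ?mulr0 //.
  apply: memN_msupp_eq0; apply: contraTN Nc => /msize_mdeg_lt lt.
  rewrite -ltnNge; apply: leq_trans (leq_bigmax (F := fun A => msize (v A)) (A :\ e)).
  apply: leq_ltn_trans lt; rewrite !mdegE; apply: leq_sum => i _.
  rewrite mnmBE mnmDE -addnBA ?leq_addr //; exact: (mnm_lepP le1 i).
exists w => B; apply/mpolyP=> c; rewrite mcoeff_tdiff -strandE.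
set a := (c + _)%MM.
have strandw A : strand w A a = if (mlcms A <= a)%MM then W A a else 0.
  by rewrite /strand; case: ifP => // Aa; rewrite hw submK.
under eq_bigr do rewrite strandw.
rewrite /W /vertex; case: pickP => [e0 e0a|none]; last first.
  rewrite big1 => [|e _]; last by rewrite if_same mulr0.
  have B0 : B = set0.
    apply/setP=> k; rewrite inE; apply/negP=> kB; have := none k.
    by have /mlcms_lep/(_ _ kB) -> : (mlcms B <= a)%MM by apply: lem_addl.
  by rewrite strandE B0 ve mcoeff0.
have cycle C := strand_cycle C a v0.
rewrite -[RHS](simplex_contraction (f := strand v ^~ a) e0 B cycle).
(* The cut-off on [e |: B] is harmless: as [m e0 <= a], if the lcm of [e |: B] fails to divide, so
   does that of [(e |: B) :\ e0]. *)
apply: eq_bigr => e _; congr (_ * _); case: ifP => // /negbT.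
case: ifP => // e0B nle; rewrite /strand ifN ?mulr0 //.
apply: contraNN nle => /mlcms_lep h; apply/mlcms_lep=> k kB.
by have [->|ne] := eqVneq k e0; [exact: e0a | apply: h; rewrite in_setD1 ne].
Qed.

End Taylor.

Lemma ideal_gen_mono (A : comNzRingType) (S S' : A -> Prop) f :
  (forall g, S g -> S' g) -> ideal_gen S f -> ideal_gen S' f.
Proof.
by move=> sub [k [a [g [hg ->]]]]; exists k, a, g; split=> // l; apply/sub/hg.
Qed.

(** * The Taylor complex as a graded free resolution *)

Section TaylorComplex.
Variables (K : fieldType) (n q : nat) (m : 'I_q -> 'X_{1..n}).
Implicit Types (e : 'I_q) (A B : {set 'I_q}).
Implicit Types w : {set 'I_q} -> {mpoly K[n]}.

Local Notation coef := (taylor_coef K m).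
Local Notation lcm := (mlcms m).

Definition faces i := [set A : {set 'I_q} | #|A| == i].

Definition face i (j : 'I_#|faces i|) : {set 'I_q} := enum_val j.

Lemma card_face i (j : 'I_#|faces i|) : #|face j| = i.
Proof. by have := enum_valP j; rewrite inE => /eqP. Qed.

Lemma faceP i A : #|A| = i -> exists j : 'I_#|faces i|, face j = A.
Proof.
move=> cA; have AT : A \in faces i by rewrite inE cA.
by exists (enum_rank_in AT A); rewrite /face enum_rankK_in.
Qed.

Definition taylor : free_complex K n := {|
  rank i := #|faces i.+1|;
  shift i j := (mdeg (lcm (face j)))%:Z;
  diff i := \matrix_(j, k) coef (face j) (face k);
  aug := \col_j coef (face j) set0 |}.

(** Extension by zero from faces of size [i] to all subsets, so that [taylor_exact] applies in every
    homological degree. *)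
Definition chain i (v : 'rV[{mpoly K[n]}]_#|faces i|) A :=
  \sum_(j | face j == A) v 0 j.

Lemma chain_face i (v : 'rV[{mpoly K[n]}]_#|faces i|) j : chain v (face j) = v 0 j.
Proof. by rewrite /chain (big_pred1 j) // => k; rewrite /= (inj_eq enum_val_inj). Qed.

Lemma chain_out i (v : 'rV[{mpoly K[n]}]_#|faces i|) A : #|A| <> i -> chain v A = 0.
Proof.
by move=> ne; rewrite /chain big_pred0 // => j; apply/eqP=> e; case: ne;
   rewrite -e card_face.
Qed.

Lemma tdiff_chain i (v : 'rV[{mpoly K[n]}]_#|faces i|) B :
  \sum_j v 0 j * coef (face j) B = tdiff m (chain v) B.
Proof.
rewrite tdiffE; under [RHS]eq_bigr do rewrite mulr_suml big_mkcond.
rewrite exchange_big; apply: eq_bigr => j _; rewrite (bigD1 (face j)) //= eqxx.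
by rewrite big1 ?addr0 // => A /negPf; rewrite eq_sym => ->.
Qed.

Lemma tdiff_chain_out i (v : 'rV[{mpoly K[n]}]_#|faces i|) B :
  #|B|.+1 <> i -> tdiff m (chain v) B = 0.
Proof.
move=> ne; rewrite /tdiff big1 // => e eB; rewrite chain_out ?mulr0 ?scaler0 //.
by rewrite cardsU1 eB.
Qed.

Lemma chain_row i w A : #|A| = i ->
  chain (\row_(j < #|faces i|) w (face j)) A = w A.
Proof. by case/faceP=> j <-; rewrite chain_face mxE. Qed.

Lemma chain_exact i (v : 'rV[{mpoly K[n]}]_#|faces i.+1|) :
  (forall B, #|B| = i -> tdiff m (chain v) B = 0) <->
  exists u : 'rV_#|faces i.+2|, forall B, tdiff m (chain u) B = chain v B.
Proof.
split=> [h|[u hu] B _]; last by rewrite -(eq_tdiff _ (fun _ _ => hu _)) tdiff_tdiff.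
have [] := @taylor_exact K n q m (chain v) _ _.
- move=> B; have [/h //|ne] := eqVneq #|B| i.
  by apply: tdiff_chain_out => -[]; apply/eqP.
- by rewrite chain_out // cards0.
(* [w] may have components of every size; those of size [i.+2] alone already bound [v]. *)
move=> w hw; exists (\row_j w (face j)) => B.
have [cB|ne] := eqVneq #|B| i.+1.
  by rewrite -hw; apply: eq_tdiff => e eB; rewrite chain_row // cardsU1 eB cB.
by rewrite chain_out ?tdiff_chain_out //; [case|]; apply/eqP.
Qed.

Lemma taylor_diffE i (v : 'rV_(rank taylor i.+1)) k :
  (v *m diff taylor i) 0 k = tdiff m (chain v) (face k).
Proof. by rewrite mxE -tdiff_chain; apply: eq_bigr => j _; rewrite mxE. Qed.

Lemma taylor_augE (v : 'rV_(rank taylor 0)) :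
  v *m aug taylor = (tdiff m (chain v) set0)%:M.
Proof.
apply/rowP=> j; rewrite (ord1 j) !mxE -tdiff_chain mulr1n.
by apply: eq_bigr => k _; rewrite mxE.
Qed.

Lemma chain_eqP i (u v : 'rV[{mpoly K[n]}]_#|faces i|) :
  (forall B, #|B| = i -> chain u B = chain v B) -> u = v.
Proof.
by move=> h; apply/rowP=> j; rewrite -!chain_face; apply: h; rewrite card_face.
Qed.

Definition monomial_ideal : {mpoly K[n]} -> Prop :=
  ideal_gen (fun f => exists k, f = 'X_[m k]).

Lemma monomial_ideal_mcoeff (f : {mpoly K[n]}) c :
  monomial_ideal f -> f@_c != 0 -> exists k, (m k <= c)%MM.
Proof.
case=> k [a [g [hg ->]]]; rewrite raddf_sum => nz.
have [l hl] : exists l, (a l * g l)@_c != 0.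
  apply/existsP; apply: contraT; rewrite negb_exists => /forallP h.
  by move: nz; rewrite big1 ?eqxx //= => l _; apply/eqP; have := h l; rewrite negbK.
have [i gi] := hg l; exists i; move: hl; rewrite gi mulrC mcoeffXM.
by case: ifP => //; rewrite eqxx.
Qed.

Lemma tdiff_set0 w : tdiff m w set0 = \sum_e w [set e] * 'X_[m e].
Proof.
rewrite /tdiff; apply: eq_big => [e|e _]; first by rewrite inE.
rewrite setU0 mlcms1 mlcms0 sgn0 scale1r mulrC; congr (_ * 'X_[_]).
by apply/mnmP=> i; rewrite mnmBE mnm0E subn0.
Qed.

Lemma taylor_exact_onto : exact_onto taylor monomial_ideal.
Proof.
split=> [f|v|i v].
- split=> [[k [a [g [hg ->]]]]|[v]].
    have /fin_all_exists[c hc] := hg.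
    (* Place each coefficient [a l] on the singleton of a generator equal to [g l]. *)
    exists (\sum_l a l *: \row_j (face j == [set c l])%:R).
    rewrite taylor_augE tdiff_set0; congr (_%:M).
    under [LHS]eq_bigr => e _.
      rewrite -[chain _ _](_ : \sum_l a l * (e == c l)%:R = _); last first.
        have [j ej] : exists j : 'I_#|faces 1|, face j = [set e].
          by apply: faceP; rewrite cards1.
        rewrite -ej chain_face summxE; apply: eq_bigr => l _.
        by rewrite !mxE ej (inj_eq set1_inj).
      rewrite mulr_suml; over.
    rewrite exchange_big; apply: eq_bigr => l _ /=; rewrite (bigD1 (c l)) //=.
    rewrite eqxx mulr1 -hc big1 ?addr0 // => e /negPf ->.
    by rewrite mulr0 mul0r.
  rewrite taylor_augE tdiff_set0 => /matrixP/(_ 0 0); rewrite !mxE !mulr1n => <-.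
  by exists q, (fun e => chain v [set e]), (fun e => 'X_[m e]); split=> // e; exists e.
- rewrite taylor_augE; split=> [/matrixP/(_ 0 0)|[u ->]].
    rewrite !mxE mulr1n => e; have [] := chain_exact (i := 0) v.
    move=> [B /eqP|u hu _]; first by rewrite cards_eq0 => /eqP ->.
    exists u; apply: chain_eqP => B cB; have [j <-] := faceP cB.
    by rewrite -hu chain_face taylor_diffE.
  rewrite -[RHS](raddf0 scalar_mx); congr (_%:M).
  have [_ h] := chain_exact (i := 0) (u *m diff taylor 0).
  apply: h; last by rewrite cards0.
  exists u => B; have [cB|ne] := eqVneq #|B| 1%N.
    by have [j <-] := faceP cB; rewrite chain_face taylor_diffE.
  by rewrite chain_out ?tdiff_chain_out //; [case|]; apply/eqP.
split=> [e|[u ->]].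
  have [] := chain_exact (i := i.+1) v.
  move=> [B cB|u hu _].
    by have [j <-] := faceP cB; rewrite -taylor_diffE e mxE.
  exists u; apply: chain_eqP => B cB; have [j <-] := faceP cB.
  by rewrite -hu chain_face taylor_diffE.
apply/rowP=> k; rewrite taylor_diffE mxE.
have [_ h] := chain_exact (i := i.+1) (u *m diff taylor i.+1).
apply: h; last by rewrite card_face.
exists u => B; have [cB|ne] := eqVneq #|B| i.+2.
  by have [j <-] := faceP cB; rewrite chain_face taylor_diffE.
by rewrite chain_out ?tdiff_chain_out //; [case|]; apply/eqP.
Qed.

Lemma mdeg_sub (a b : 'X_{1..n}) : (a <= b)%MM ->
  (mdeg (b - a)%MM)%:Z = (mdeg b)%:Z - (mdeg a)%:Z.
Proof. by move=> ab; rewrite -{2}(submK ab) mdegD PoszD addrK. Qed.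

Lemma taylor_coef_homog A B :
  zhomog ((mdeg (lcm A))%:Z - (mdeg (lcm B))%:Z) (coef A B).
Proof.
apply: zhomog_sum => e _; case: eqP => [->|_]; last exact: zhomog0.
apply/zhomogP=> c; rewrite mcoeffZ mcoeffX.
have [<- _|_] := eqVneq _ c.
  by rewrite mdeg_sub //; apply: mlcmsU1.
by rewrite mulr0 eqxx.
Qed.

Lemma taylor_graded : graded_maps taylor.
Proof.
split=> [j|i j k]; rewrite !mxE; last exact: taylor_coef_homog.
by have := taylor_coef_homog (face j) set0; rewrite mlcms0 mdeg0 subr0.
Qed.

Lemma taylor_finite : finite_length taylor.
Proof.
exists q => i qi; apply/eqP; rewrite /= cards_eq0; apply/eqP/setP=> A.
rewrite !inE; apply/negP=> /eqP cA; have := max_card A.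
by rewrite card_ord cA ltnNge (ltnW qi).
Qed.

(** The private variable of [e] divides the lcm of [e |: B] but not that of [B], so the nonzero
    entries are, up to sign, nonconstant monomials. *)
Lemma taylor_minimal :
  (forall k, exists2 x, (0 < m k x)%N & forall l, l != k -> m l x = 0%N) ->
  minimal_maps taylor.
Proof.
move=> private i j k; rewrite mxE /taylor_coef.
have [e /andP[eB eA]|none] :=
    pickP [pred e | (e \notin face k) && (face j == e |: face k)]; last first.
  rewrite big1 => [|e eB]; last by have := none e; rewrite /= eB => /= ->.
  by exists 0%N, (fun _ => 0), (fun _ => 0); split=> [[]|] //; rewrite big_ord0.
rewrite (bigD1 e) //= eA big1 ?addr0 => [|f /andP[fB fe]]; last first.
  case: eqP => // fA; have := setU11 f (face k).
  by rewrite -fA (eqP eA) !inE (negPf fe) (negPf fB).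
rewrite -mul_mpolyC mulrC; apply: irrelevant_monomial; rewrite (eqP eA).
have [x ex xe] := private e; apply: contraTneq ex => /mnmP/(_ x).
rewrite mnmBE mnm0E !mnmE [X in (_ - X)%N]big1 => [|l lB]; last first.
  by apply: xe; apply: contraNneq eB => <-.
rewrite subn0 (bigD1 e) ?setU11 //= => /eqP; rewrite -leqn0 geq_max.
by rewrite -leqNgt => /andP[].
Qed.

End TaylorComplex.

(** * Edge ideals and star forests *)

Lemma exact_onto_ext (K : fieldType) n (F : free_complex K n)
    (I J : {mpoly K[n]} -> Prop) :
  (forall f, I f <-> J f) -> exact_onto F I -> exact_onto F J.
Proof.
by move=> IJ [h0 h1 h2]; split=> // f; split=> [/IJ/h0|/h0/IJ].
Qed.

Section EdgeMonomials.
Variables (K : fieldType) (n q : nat) (e : 'I_q -> {set 'I_n}).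
Implicit Types (A : {set 'I_q}) (E : {set {set 'I_n}}).

Definition edge_monomial (s : {set 'I_n}) : 'X_{1..n} :=
  [multinom (x \in s : nat) | x < n].

Local Notation mon := (fun k => edge_monomial (e k)).

Lemma edge_monomial_set2 (i j : 'I_n) : i != j ->
  'X_[edge_monomial [set i; j]] = 'X_i * 'X_j :> {mpoly K[n]}.
Proof.
move=> ij; rewrite -mpolyXD; congr 'X_[_]; apply/mnmP=> x.
rewrite mnmE mnmDE !mnm1E !inE ![x == _]eq_sym.
by case: eqVneq => // <-; rewrite eq_sym (negPf ij).
Qed.

Lemma edge_ideal_monomial E : is_graph E -> E = [set e k | k : 'I_q] ->
  forall f : {mpoly K[n]}, monomial_ideal mon f <-> edge_ideal E f.
Proof.
move=> gE EE f; split; apply: ideal_gen_mono => g.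
  case=> k ->; have ekE : e k \in E by rewrite EE imset_f.
  have /eqP/cards2P[i [j [ij ek]]] := gE _ ekE.
  by exists i, j; rewrite -ek; split=> //; rewrite ek edge_monomial_set2.
case=> i [j [ijE ->]]; have := gE _ ijE; rewrite cards2.
case: eqVneq => // ij _; move: ijE; rewrite EE => /imsetP[k _ ek].
by exists k; rewrite -ek edge_monomial_set2.
Qed.

(** The lcm of squarefree monomials is squarefree, supported on the union. *)
Lemma mdeg_mlcms_edges A : mdeg (mlcms mon A) = #|\bigcup_(k in A) e k|.
Proof.
rewrite mdegE -sum1_card [RHS]big_mkcond; apply: eq_bigr => x _.
rewrite mnmE; apply/eqP; rewrite eqn_leq; apply/andP; split.
  apply/bigmax_leqP=> k kA; rewrite mnmE; case: (boolP (x \in e k)) => // xk.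
  by rewrite ifT //; apply/bigcupP; exists k.
case: ifP => // /bigcupP[k kA xk].
apply: leq_trans (leq_bigmax_cond (F := fun k => edge_monomial (e k) x) k kA).
by rewrite mnmE xk.
Qed.

Lemma mdeg_mlcms_edges_le A : (forall k, #|e k| = 2%N) ->
  (mdeg (mlcms mon A) <= n)%N /\ (mdeg (mlcms mon A) <= 2 * #|A|)%N.
Proof.
move=> e2; rewrite mdeg_mlcms_edges; split.
  by rewrite -[X in (_ <= X)%N](card_ord n) max_card.
rewrite mulnC -sum_nat_const.
elim/big_ind2: _ => [|S a T b Sa Tb|k _]; rewrite ?cards0 ?e2 //.
by apply: leq_trans (leq_card_setU _ _) _; rewrite leq_add.
Qed.

End EdgeMonomials.

Lemma mdeg_edge_monomial n (s : {set 'I_n}) : mdeg (edge_monomial s) = #|s|.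
Proof.
rewrite mdegE -sum1_card [RHS]big_mkcond; apply: eq_bigr => x _.
by rewrite mnmE; case: ifP.
Qed.

Lemma mdeg_le n (a b : 'X_{1..n}) : (a <= b)%MM -> (mdeg a <= mdeg b)%N.
Proof. by move=> /mnm_lepP ab; rewrite !mdegE leq_sum. Qed.

Lemma betti_edge_ideal_supp (K : fieldType) n E (D : diagram n) i d :
  is_graph E -> is_betti_diagram (@edge_ideal K n E) D -> coef D i d != 0 ->
  exists2 k : nat, d = (i + k + 2)%:Z & (k <= i)%N && (i + k + 2 <= n)%N.
Proof.
move=> gE [F [mF ->]]; rewrite coef_diagram_of pnatr_eq0 cards_eq0.
case/set0Pn=> j; rewrite inE => /eqP jd.
pose e (k : 'I_#|E|) : {set 'I_n} := enum_val k.
have EE : E = [set e k | k : 'I_#|E|].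
  apply/setP=> s; apply/idP/imsetP=> [sE|[k _ ->]]; last exact: enum_valP.
  by exists (enum_rank_in sE s); rewrite /e ?enum_rankK_in.
have e2 k : #|e k| = 2%N by apply/gE/enum_valP.
have eI := @edge_ideal_monomial K _ _ _ _ gE EE.
have [l] := minimal_shift_in j mF (taylor_graded K _)
  (exact_onto_ext eI (taylor_exact_onto K _)).
have := minimal_shift_ge (c := 2) j _ mF; rewrite jd /= => lower dl.
have {lower} : (i + 2)%:Z <= d.
  apply: lower => f c /eI fI /(monomial_ideal_mcoeff fI)[k].
  by move/mdeg_le; rewrite mdeg_edge_monomial e2.
have [] := mdeg_mlcms_edges_le (face l) e2; rewrite card_face -dl lez_nat.
(* The lower bound makes this subtraction exact; [a <= 2 * (i + 1)] becomes [k <= i]. *)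
set a := mdeg _ => an ai ia; exists (a - (i + 2))%N; first by congr Posz; lia.
lia.
Qed.

Section StarForest.
Variables (K : fieldType) (n : nat) (x0 : 'I_n) (i k : nat).
Hypotheses (ki : (k <= i)%N) (ikn : (i + k + 2 <= n)%N).

Definition vertex (x : nat) : 'I_n := insubd x0 x.

Lemma val_vertex x : (x < n)%N -> vertex x = x :> nat.
Proof. by move=> xn; rewrite val_insubd xn. Qed.

(* k disjoint edges and a star with i + 1 - k edges. *)
Definition star_edge (j : 'I_i.+1) : {set 'I_n} :=
  [set vertex (minn j k); vertex (k.+1 + j)].

Definition star_forest : {set {set 'I_n}} := [set star_edge j | j : 'I_i.+1].

(** Centres occupy the vertices 0 to [k], leaves the vertices [k + 1] to [i + k + 1], so the default
    [x0] is never reached. *)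
Lemma val_leaf (j : 'I_i.+1) : vertex (k.+1 + j) = (k.+1 + j)%N :> nat.
Proof. by rewrite val_vertex //; have := ltn_ord j; lia. Qed.

Lemma val_center (j : nat) : vertex (minn j k) = minn j k :> nat.
Proof. by rewrite val_vertex //; lia. Qed.

Lemma star_forest_graph : is_graph star_forest.
Proof.
move=> s /imsetP[j _ ->]; rewrite cards2.
case: eqVneq => // /(congr1 (@nat_of_ord n)); rewrite val_leaf val_center; lia.
Qed.

Local Notation mon := (fun j => edge_monomial (star_edge j)).

Lemma star_forest_minimal :
  minimal_graded_free_resolution (taylor K mon) (@edge_ideal K n star_forest).
Proof.
split; [exact: taylor_graded | exact: taylor_finite | |].
  apply: exact_onto_ext (taylor_exact_onto K _).
  exact: edge_ideal_monomial star_forest_graph _.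
apply: taylor_minimal => j; exists (vertex (k.+1 + j)).
  by rewrite mnmE !inE eqxx orbT.
move=> l lj; rewrite mnmE; apply/eqP; rewrite eqb0; apply/negP.
rewrite !inE => /orP[] /eqP/(congr1 (@nat_of_ord n)); rewrite !val_leaf.
  by rewrite val_center; lia.
by move=> h; case/eqP: lj; apply/val_inj => /=; lia.
Qed.

(** Each edge contributes one leaf, and there are [k + 1] centres in all. *)
Lemma star_forest_union_le (A : {set 'I_i.+1}) :
  (#|\bigcup_(j in A) star_edge j| <= #|A| + k.+1)%N.
Proof.
pose leaf (j : 'I_i.+1) := vertex (k.+1 + j).
have sub : \bigcup_(j in A) star_edge j \subset
    leaf @: A :|: [set vertex c | c : 'I_k.+1].
  apply/bigcupsP=> j jA; apply/subsetP=> x; rewrite !inE => /orP[]/eqP->.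
    have lt : (minn j k < k.+1)%N by lia.
    by apply/orP; right; apply/imsetP; exists (Ordinal lt).
  by apply/orP; left; apply: imset_f.
apply: leq_trans (subset_leq_card sub) _.
apply: leq_trans (leq_card_setU _ _) _; apply: leq_add; first exact: leq_imset_card.
by apply: leq_trans (leq_imset_card _ _) _; rewrite card_ord.
Qed.

Lemma star_forest_union : #|\bigcup_(j in [set: 'I_i.+1]) star_edge j| = (i + k + 2)%N.
Proof.
apply/eqP; rewrite eqn_leq; apply/andP; split.
  by apply: leq_trans (star_forest_union_le _) _; rewrite cardsT card_ord; lia.
have inj : injective (widen_ord ikn) by move=> a b /(congr1 val)/= /val_inj.
rewrite -[X in (X <= _)%N]card_ord -cardsT -(card_imset _ inj).
apply/subset_leq_card/subsetP=> x /imsetP[y _ ->].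
(* A vertex [y <= k] is the centre of edge [y], which exists as [k <= i]; any other is the leaf of
   edge [y - (k + 1)]. *)
have ylt := ltn_ord y; apply/bigcupP; have [yk|ky] := leqP y k.
  have yi : (y < i.+1)%N by lia.
  exists (Ordinal yi) => //; rewrite !inE; apply/orP; left; apply/eqP/val_inj.
  by rewrite /= val_center /=; lia.
have yi : (y - k.+1 < i.+1)%N by lia.
exists (Ordinal yi) => //; rewrite !inE; apply/orP; right; apply/eqP/val_inj.
by rewrite /= val_vertex; lia.
Qed.

Lemma star_forest_coef (i' : 'I_n.+1) k' :
  coef (diagram_of (taylor K mon)) i' (i' + k' + 2)%:Z != 0 ->
  (i' <= i)%N && (k' <= k)%N.
Proof.
rewrite coef_diagram_of pnatr_eq0 cards_eq0 => /set0Pn[j]; rewrite inE /= eqz_nat.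
rewrite mdeg_mlcms_edges => /eqP; have := star_forest_union_le (face j).
have := max_card (face j); rewrite card_ord card_face; lia.
Qed.

Lemma star_forest_coef_top (i' : 'I_n.+1) : i' = i :> nat ->
  coef (diagram_of (taylor K mon)) i' (i + k + 2)%:Z != 0.
Proof.
move=> ii; rewrite coef_diagram_of pnatr_eq0 cards_eq0; apply/set0Pn.
have [|j ej] := @faceP i.+1 i'.+1 setT; first by rewrite cardsT card_ord ii.
by exists j; rewrite inE /= ej eqz_nat mdeg_mlcms_edges star_forest_union.
Qed.

End StarForest.

(** * Dimension of the cone *)

(** The matrix of the functionals on the vectors [D t] is triangular for the order given by [key],
    hence invertible; since the functionals separate [W], the [D t] also span. *)
Lemma has_dim_triangular (V : lmodType rat) (W : V -> Prop) (T : finType)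
    (phi : T -> {scalar V}) (P : {set T}) (D : T -> V) (key : T -> nat) :
  (forall v w, W v -> W w -> (forall t, t \in P -> phi t v = phi t w) -> v = w) ->
  (forall (I : finType) (c : I -> rat) (v : I -> V),
     (forall i, W (v i)) -> W (\sum_i c i *: v i)) ->
  (forall t, t \in P -> W (D t)) ->
  {in P &, injective key} ->
  (forall s t, s \in P -> t \in P -> phi t (D s) != 0 -> (key t <= key s)%N) ->
  (forall t, t \in P -> phi t (D t) != 0) ->
  has_dim W #|P|.
Proof.
move=> Wext Wcomb WD keyI tri diag.
pose b (k : 'I_#|P|) := D (enum_val k).
have Pk (k : 'I_#|P|) : enum_val k \in P by apply: enum_valP.
pose M := \matrix_(k, l) phi (enum_val l) (b k) : 'M[rat]_#|P|.
have phi_comb (c : 'rV_#|P|) l :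
    phi (enum_val l) (\sum_k c 0 k *: b k) = (c *m M) 0 l.
  by rewrite linear_sum mxE; apply: eq_bigr => k _; rewrite linearZ mxE.
have Mfree (c : 'rV_#|P|) : c *m M = 0 -> c = 0.
  move=> cM; apply/rowP=> k0; rewrite mxE; apply/eqP; apply: contraT => ck0.
  (* Look at the column of the index of largest key in a relation: by triangularity no other term of
     the relation meets it. *)
  case: (arg_maxnP (fun k => key (enum_val k)) (P := fun k => c 0 k != 0) ck0).
  move=> k ck kmax; move/rowP/(_ k): cM; rewrite !mxE (bigD1 k) //= big1 => [|l lk].
    by rewrite addr0 mxE => /eqP; rewrite mulf_eq0 (negPf ck) (negPf (diag _ (Pk k))).
  apply/eqP; apply: contraT; rewrite mulf_eq0 negb_or mxE => /andP[cl Ml].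
  have le1 := tri _ _ (Pk l) (Pk k) Ml.
  have le2 : (key (enum_val l) <= key (enum_val k))%N := kmax l cl.
  case/eqP: lk; apply/enum_val_inj/keyI => //.
  by apply/eqP; rewrite eqn_leq le2 le1.
have Munit : M \in unitmx by rewrite -row_free_unit; apply: inj_row_free.
exists b; split=> [k|c c0 k|v Wv]; first exact: WD.
  have /rowP/(_ k) : \row_k c k = 0.
    apply: Mfree; apply/rowP=> l; rewrite -phi_comb mxE.
    under eq_bigr do rewrite mxE.
    by rewrite c0 linear0.
  by rewrite !mxE.
pose c := (\row_l phi (enum_val l) v) *m invmx M.
exists (c 0); apply: Wext => //; first by apply: Wcomb => k; apply: WD.
move=> t tP; rewrite -(enum_rankK_in tP tP) phi_comb.
by rewrite /c mulmxKV // mxE.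
Qed.

Section Diagrams.
Variables (n : nat).
Implicit Types (D : diagram n) (i : 'I_n.+1) (d : int).

Fact coef_is_scalar i d : scalar (fun D => coef D i d).
Proof.
move=> a u v; rewrite /coef -[RHS]/(_ * _ + _).
by rewrite [LHS]monalg.mcoeffD monalg.mcoeffZ.
Qed.

Definition coef_at i d : diagram n -> rat := fun D => coef D i d.

HB.instance Definition _ i d :=
  GRing.isLinear.Build rat (diagram n) rat _ (coef_at i d) (coef_is_scalar i d).

Lemma diagram_ext D D' : (forall i d, coef D i d = coef D' i d) -> D = D'.
Proof. by move=> h; apply/monalg.malgP=> -[i d]; apply: h. Qed.

End Diagrams.

Lemma lin_span_sub (V : lmodType rat) (S Q : V -> Prop) :
  (forall (I : finType) (c : I -> rat) (v : I -> V),
     (forall i, Q (v i)) -> Q (\sum_i c i *: v i)) ->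
  (forall v, S v -> Q v) -> forall v, lin_span S v -> Q v.
Proof. by move=> Qc SQ v [k [c [w [Sw ->]]]]; apply: Qc => i; apply/SQ/Sw. Qed.

Lemma cone_sub (V : lmodType rat) (S Q : V -> Prop) :
  (forall (I : finType) (c : I -> rat) (v : I -> V),
     (forall i, Q (v i)) -> Q (\sum_i c i *: v i)) ->
  (forall v, S v -> Q v) -> forall v, cone S v -> Q v.
Proof. by move=> Qc SQ v [k [c [w [_ Sw ->]]]]; apply: Qc => i; apply/SQ/Sw. Qed.

Lemma cone_gen (V : lmodType rat) (S : V -> Prop) v : S v -> cone S v.
Proof.
by exists 1%N, (fun _ => 1), (fun _ => v); split=> //; rewrite big_ord1 scale1r.
Qed.

Lemma lin_span_gen (V : lmodType rat) (S : V -> Prop) v : S v -> lin_span S v.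
Proof.
by exists 1%N, (fun _ => 1), (fun _ => v); split=> //; rewrite big_ord1 scale1r.
Qed.

Lemma lin_span0 (V : lmodType rat) (S : V -> Prop) : lin_span S 0.
Proof.
by exists 0%N, (fun _ => 0), (fun _ => 0); split=> [[]|] //; rewrite big_ord0.
Qed.

Lemma lin_spanZD (V : lmodType rat) (S : V -> Prop) a v w :
  lin_span S v -> lin_span S w -> lin_span S (a *: v + w).
Proof.
move=> [k [c [x [Sx ->]]]] [l [d [y [Sy ->]]]].
pose join T (f : 'I_k -> T) (g : 'I_l -> T) (z : 'I_(k + l)) :=
  match split z with inl i => f i | inr j => g j end.
exists (k + l)%N, (join _ (fun i => a * c i) d), (join _ x y); split.
  by move=> z; rewrite /join; case: (split z).
rewrite big_split_ord /= scaler_sumr; congr (_ + _); apply: eq_bigr => i _.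
  by rewrite /join -[lshift _ _]/(unsplit (inl i)) unsplitK scalerA.
by rewrite /join -[rshift _ _]/(unsplit (inr i)) unsplitK.
Qed.

Lemma lin_span_comb (V : lmodType rat) (S : V -> Prop) (I : finType)
    (c : I -> rat) (v : I -> V) :
  (forall i, lin_span S (v i)) -> lin_span S (\sum_i c i *: v i).
Proof.
move=> Sv; elim/big_rec: _ => [|i x _ Sx]; first exact: lin_span0.
exact: lin_spanZD.
Qed.

(* The pair (i, k) stands for homological degree i and internal degree
   i + k + 2. *)
Definition betti_positions n : {set 'I_n.+1 * 'I_n.+1} :=
  [set p : 'I_n.+1 * 'I_n.+1 | (p.2 <= p.1)%N && (p.1 + p.2 + 2 <= n)%N].

Lemma edge_betti_dim (K : fieldType) n : (0 < n)%N ->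
  cone_has_dim (@edge_betti_cone K n) #|betti_positions n|.
Proof.
move=> n0; pose x0 := Ordinal n0.
pose supp (D : diagram n) := forall i d, coef D i d != 0 ->
  exists2 k : nat, d = (i + k + 2)%:Z & (k <= i)%N && (i + k + 2 <= n)%N.
have supp_comb (I : finType) (c : I -> rat) (v : I -> diagram n) :
    (forall i, supp (v i)) -> supp (\sum_i c i *: v i).
  move=> sv i d; rewrite -[coef _ _ _]/(coef_at i d _) linear_sum => nz.
  have /existsP[j cj] : [exists j, coef_at i d (v j) != 0].
    apply: contraT; rewrite negb_exists => /forallP h.
    rewrite big1 ?eqxx // in nz => j _; have := h j; rewrite negbK => /eqP e.
    by rewrite linearZ /= e mulr0.
  exact: sv cj.
have supp_span v : lin_span (@edge_betti_cone K n) v -> supp v.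
  apply: (lin_span_sub supp_comb); apply: (cone_sub supp_comb) => {}v [E [gE vE]].
  by move=> i d; apply: betti_edge_ideal_supp vE.
pose phi (p : 'I_n.+1 * 'I_n.+1) : {scalar diagram n} :=
  coef_at p.1 (p.1 + p.2 + 2)%:Z.
pose D (p : 'I_n.+1 * 'I_n.+1) : diagram n :=
  diagram_of (taylor K (fun j => edge_monomial (@star_edge _ x0 p.1 p.2 j))).
(* Base [n.+1] encoding of the pair: injective because [p.1 <= n], and monotone in both
   coordinates. *)
apply: (@has_dim_triangular _ _ _ phi _ D (fun p => p.1 + p.2 * n.+1)%N).
- move=> v w /supp_span sv /supp_span sw h; apply: diagram_ext => i d.
  have hk (k : nat) : (k <= i)%N && (i + k + 2 <= n)%N ->
      coef v i (i + k + 2)%:Z = coef w i (i + k + 2)%:Z.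
    move=> ik; have kn : (k < n.+1)%N by lia.
    by apply: (h (i, Ordinal kn)); rewrite inE.
  have [v0|/sv[k -> /hk //]] := eqVneq (coef v i d) 0.
  by have [->//|/sw[k -> /hk //]] := eqVneq (coef w i d) 0.
- by move=> I c v; apply: lin_span_comb.
- move=> [i k]; rewrite inE /= => /andP[ki ikn].
  apply/lin_span_gen/cone_gen; exists (star_forest x0 i k).
  split; first exact: star_forest_graph.
  by exists (taylor K (fun j : 'I_i.+1 => edge_monomial (star_edge x0 k j))); split => //;
    apply: star_forest_minimal.
- move=> [i k] [i' k'] _ _ /= e.
  have ei : i = i' :> nat.
    have := congr1 (modn^~ n.+1) e.
    by rewrite /= ![(_ + _ * n.+1)%N]addnC !modnMDl !modn_small.
  have ek : (k * n.+1 = k' * n.+1)%N by lia.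
  congr (_, _); apply/val_inj => //=; apply/eqP.
  by rewrite -(eqn_pmul2r (ltn0Sn n)) ek.
- move=> [i k] [i' k']; rewrite !inE /= => /andP[ki ikn] _.
  case/(star_forest_coef ki ikn)/andP=> ii kk.
  by apply: leq_add => //; rewrite leq_mul2r kk orbT.
by move=> [i k]; rewrite inE /= => /andP[ki ikn]; apply: star_forest_coef_top.
Qed.

(** * Counting the positions *)

Lemma sum_interval N a b :
  (\sum_(i < N) ((a <= i) && (i < b) : nat) = minn N b - a)%N.
Proof. by elim: N => [|N IH]; rewrite ?big_ord0 ?big_ord_recr ?IH /=; lia. Qed.

Lemma card_betti_positions n :
  #|betti_positions n| = (\sum_(k < n.+1) (n.-1 - 2 * k))%N.
Proof.
transitivity (\sum_(i < n.+1) \sum_(k < n.+1)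
    ((k <= i) && (i + k + 2 <= n) : nat))%N.
  rewrite pair_bigA -sum1_card big_mkcond; apply: eq_bigr => p _.
  by rewrite inE; case: ifP.
rewrite exchange_big; apply: eq_bigr => k _.
(* For fixed [k], the index [i] runs over the interval from [k] up to, excluding, [n - 1 - k];
   truncated subtraction covers the empty case. *)
rewrite -[RHS](_ : minn n.+1 (n.-1 - k) - k = _)%N; last lia.
by rewrite -sum_interval; apply: eq_bigr => i _; lia.
Qed.

(** Removing the term [k = 0] and reindexing lowers [r] by one; terms with [k >= r] are truncated to
    0, so any [N >= r] will do. *)
Lemma sum_even r N : (r <= N)%N -> (\sum_(k < N) (2 * r - 2 * k) = r ^ 2 + r)%N.
Proof.
elim: r N => [|r IH] [|N] // rN; first by rewrite big_ord0.
  by rewrite big1.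
rewrite big_ord_recl (eq_bigr (fun k : 'I_N => 2 * r - 2 * k)%N) => [|k _].
  by rewrite IH //= -!mulnn; nia.
by rewrite /= /bump; lia.
Qed.

Lemma sum_odd r N : (r <= N)%N -> (\sum_(k < N) ((2 * r).-1 - 2 * k) = r ^ 2)%N.
Proof.
elim: r N => [|r IH] [|N] // rN; first by rewrite big_ord0.
  by rewrite big1.
rewrite big_ord_recl (eq_bigr (fun k : 'I_N => (2 * r).-1 - 2 * k)%N) => [|k _].
  by rewrite IH //= -!mulnn; nia.
by rewrite /= /bump; lia.
Qed.

Unset Implicit Arguments.

Theorem theorem3p3 (K : fieldType) (n : nat) (hn : (0 < n)%N) :
  (forall r : nat, n = (2 * r)%N ->
     cone_has_dim (@edge_betti_cone K n) (r ^ 2)%N) /\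
  (forall r : nat, n = (2 * r + 1)%N ->
     cone_has_dim (@edge_betti_cone K n) (r ^ 2 + r)%N).
Proof.
have dim := edge_betti_dim K hn; rewrite card_betti_positions in dim.
split=> r nr.
  by rewrite -(@sum_odd r n.+1) -?nr //; lia.
have n1 : n.-1 = (2 * r)%N by lia.
by rewrite -(@sum_even r n.+1) -?n1 //; lia.
Qed.
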